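(* Let $\mathcal H$, $\mathcal K$, $\mathcal H_0$ be Hilbert spaces and let $p\in\mathcal H\otimes\mathcal H_0$ and $q\in\mathcal K\otimes\mathcal H_0$ be vectors. Then there exists an operator $X\in\mathcal L(\mathcal H,\mathcal K)$ satisfying $$(X\otimes I_{\mathcal H_0})p=q\quad\text{and}\quad\|X\|_{\mathcal L(\mathcal H,\mathcal K)}\le1$$ if and only if $$U_{\mathcal K,\mathcal H_0}[q]^*\,U_{\mathcal K,\mathcal H_0}[q]-U_{\mathcal H,\mathcal H_0}[p]^*\,U_{\mathcal H,\mathcal H_0}[p]\preceq0 .$$
   Context: Hilbert spaces are complex, $\otimes$ is the Hilbert space tensor product, and $\mathcal L(\mathcal H,\mathcal K)$ denotes the bounded linear operators from $\mathcal H$ to $\mathcal K$. A conjugation $k\mapsto\overline k$ on $\mathcal H_0$ (an anti-linear map with $\langle\overline f,\overline g\rangle=\overline{\langle f,g\rangle}$ and $\overline{\overline f}=f$) is fixed. $\mathcal C_2(\mathcal H_0,\mathcal H)$ is the Hilbert space of Hilbert–Schmidt operators from $\mathcal H_0$ to $\mathcal H$ with inner product $\langle S,T\rangle=\mathrm{tr}(T^*S)$. The map $U_{\mathcal H,\mathcal H_0}:\mathcal H\otimes\mathcal H_0\to\mathcal C_2(\mathcal H_0,\mathcal H)$ is the unitary operator determined on pure tensors by $U_{\mathcal H,\mathcal H_0}[h\otimes k]=h\,(\overline k)^*$, i.e. the rank-one operator $x\mapsto\langle x,\overline k\rangle h$; $U_{\mathcal K,\mathcal H_0}$ is defined in the same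 way with $\mathcal K$ in place of $\mathcal H$. *)

(* Defs.v *)
From HB Require Import structures.
From mathcomp Require Import all_boot all_order all_algebra finmap.
From mathcomp Require Import all_classical all_reals all_analysis.
From mathcomp Require Import complex sesquilinear.
From mathcomp Require analysis.showcase.summability.

Set Implicit Arguments.
Unset Strict Implicit.
Unset Printing Implicit Defensive.

Import Order.TTheory GRing.Theory Num.Theory.
Import numFieldNormedType.Exports.

Local Open Scope classical_set_scope.
Local Open Scope ring_scope.

(* Complex Hilbert spaces.  The norm of a [normedModType R[i]] is valued in    *)
(* R[i].  Inner products are linear in the first argument and conjugate-linear *)
(* in the second one.                                                          *)
HB.mixin Record CompleteNormedModule_isHilbert (R : realType) V
    of @CompleteNormedModule R[i] V := {
  hdot : {dot V for (@Num.conj R[i])} ;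
  hdotE : forall x : V, hdot x x = `|x| ^+ 2 }.

#[short(type="hilbertType")]
HB.structure Definition Hilbert (R : realType) :=
  {V of @CompleteNormedModule R[i] V & CompleteNormedModule_isHilbert R V}.

Notation "''[' u , v ]" := (hdot u v)
  (format "''[' u ,  v ]") : ring_scope.

Section Operators.
Variable R : realType.
Implicit Types H K : hilbertType R.

Definition bounded_op H K (X : H -> K) : Prop :=
  linear X /\ exists M : R[i], forall h, `|X h| <= M * `|h|.

(* [Re] because the norm of K is valued in R[i]. *)
Definition opnorm H K (X : H -> K) : R :=
  sup [set complex.Re `|X h| | h in [set h : H | `|h| <= 1]].

Definition adjoint H K (X : H -> K) : K -> H :=
  xget (fun=> 0) [set Y : K -> H | forall h k, '[X h, k] = '[h, Y k]].

(* In the order of R[i], [z <= 0] says that z is real and nonpositive. *)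
Definition nonpositive_op H (A : H -> H) : Prop := forall h, '[A h, h] <= 0.

(* The operator h k^* *)
Definition rank_one H K (h : K) (k : H) : H -> K := fun x => '[x, k] *: h.

Definition conjugation H (J : H -> H) : Prop :=
  [/\ linear_for (Num.conj \; *:%R) J,
      forall f g, '[J f, J g] = Num.conj '[f, g] &
      involutive J].

End Operators.

Section HilbertSchmidt.
Variable R : realType.
Implicit Types H K : hilbertType R.

Definition orthonormal_basis H (E : set H) : Prop :=
  [/\ forall e, E e -> '[e, e] = 1,
      forall e f, E e -> E f -> e != f -> '[e, f] = 0 &
      forall x, (forall e, E e -> '[x, e] = 0) -> x = 0].

(* [family_sum E f s]: the family (f e)_(e in E) is (unconditionally) summable *)
(* in the complex numbers, with sum s.                                         *)
Definition family_sum (T : choiceType) (E : set T) (f : T -> R[i]) (s : R[i]) :=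
  summability.partial_sum (fun e : E => f (val e) : R[i]^o)
    @ summability.totally --> (s : R[i]^o).

Definition has_trace H (A : H -> H) (t : R[i]) : Prop :=
  forall E : set H, orthonormal_basis E ->
    family_sum E (fun e => '[A e, e]) t.

Definition hilbert_schmidt H K (S : H -> K) : Prop :=
  bounded_op S /\
  forall E : set H, orthonormal_basis E ->
    exists s, family_sum E (fun e => `|S e| ^+ 2) s.

End HilbertSchmidt.

Section Tensor.
Variable R : realType.

(* The Hilbert space tensor product is determined up to a unique unitary       *)
(* operator fixing pure tensors; a model of it is a Hilbert space generated by *)
(* pure tensors whose inner products are given by the product formula.         *)
Record hilbertTensor (H K : hilbertType R) := HilbertTensor {
  tensor_space :> hilbertType R ;
  tensor : {bilinear H -> K -> tensor_space} ;
  tensor_dot : forall h h' k k',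
    '[tensor h k, tensor h' k'] = '[h, h'] * '[k, k'] ;
  tensor_dense : dense [set t : tensor_space | exists n,
    exists h : 'I_n -> H, exists k : 'I_n -> K, t = \sum_i tensor (h i) (k i)] }.

Definition tensor_op (H K H' K' : hilbertType R)
    (HK : hilbertTensor H K) (HK' : hilbertTensor H' K')
    (X : H -> H') (Y : K -> K') : HK -> HK' :=
  xget (fun=> 0) [set Z : HK -> HK' | bounded_op Z /\
    forall h k, Z (tensor HK h k) = tensor HK' (X h) (Y k)].

(* [U] is a unitary operator from T onto the Hilbert space of Hilbert-Schmidt  *)
(* operators from H0 to H with inner product <S, T> = tr (T^* S).              *)
Definition unitary_onto_HS (T H0 H : hilbertType R) (U : T -> H0 -> H) : Prop :=
  [/\ linear U,
      forall t, hilbert_schmidt (U t),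
      forall s t, has_trace (adjoint (U t) \o U s) '[s, t] &
      forall S, hilbert_schmidt S -> exists t, U t = S].

(* [U_HS J HH0] is the operator U_{H,H0} for the conjugation J of H0. *)
Definition U_HS (H H0 : hilbertType R) (J : H0 -> H0)
    (HH0 : hilbertTensor H H0) : HH0 -> H0 -> H :=
  xget (fun=> fun=> 0) [set U : HH0 -> H0 -> H | unitary_onto_HS U /\
    forall h k, U (tensor HH0 h k) = rank_one h (J k)].

End Tensor.

Arguments tensor_op {R H K H' K'} HK HK' X Y _.
Arguments U_HS {R H H0} J HH0 _.

(* Main.v *)
(* Both directions rest on the identity U[(X \otimes I) t] = X U[t]: it turns *)
(* (X \otimes I) p = q into the factorization U[q] = X U[p], and Douglas' *)
(* lemma says that a contraction X with this property exists if and only if *)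
(* |U[q] x| <= |U[p] x| for all x.  The operator U[t] is obtained from its *)
(* matrix coefficients <U[t] y, h> = <t, h \otimes J y> by the Riesz *)
(* representation theorem; for an orthonormal basis E of H0, *)
(* t = \sum_(e in E) U[t] e \otimes J e, which gives the trace formula, and *)
(* the same series with S e in place of U[t] e inverts U. *)

Require Import Defs.
From HB Require Import structures.
From mathcomp Require Import all_boot all_order all_algebra finmap.
From mathcomp Require Import all_classical all_reals all_analysis.
From mathcomp Require Import complex sesquilinear.
From mathcomp Require analysis.showcase.summability.
From mathcomp Require Import ring lra.

Set Implicit Arguments.
Unset Strict Implicit.
Unset Printing Implicit Defensive.

Import Order.TTheory GRing.Theory Num.Theory.
Import numFieldNormedType.Exports.

Local Open Scope classical_set_scope.
Local Open Scope ring_scope.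

(** Write A for U[p] and B for U[q]. As U[(X \otimes I) t] = X U[t] and U is injective, the equation
    (X \otimes I) p = q says that B = X A. Since <(B^*B - A^*A) x, x> = |B x|^2 - |A x|^2
    ([nonpositive_gram_diff]), the operator inequality means |B x| <= |A x| for all x. A contraction
    X with B = X A clearly forces this; conversely it makes A x |-> B x a well-defined contraction
    on the range of A, and [contractive_factor] supplies X on all of H. The objects [adjoint],
    [U_HS] and [tensor_op] are choices with a default value, so existence has to be proved for each,
    and uniqueness for the last two. [riesz] yields adjoints, the concrete model [slice] of U[t],
    and the Douglas factor. [slice_surj] and [slice_parseval] make [slice] unitary onto the
    Hilbert-Schmidt operators, [U_HSE] identifies it with [U_HS], and [slice_tensor_op] is the
    intertwining relation. *)

Definition hnorm (R : realType) (V : normedZmodType R[i]) (x : V) : R :=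
  complex.Re `|x|.

(** * Real-valued norms *)

Section Hnorm.
Variables (R : realType) (V : normedZmodType R[i]).
Implicit Types x y : V.

Lemma normE x : `|x| = (hnorm x)%:C%C.
Proof. by rewrite /hnorm RRe_real // normr_real. Qed.

Lemma hnorm_ge0 x : 0 <= hnorm x.
Proof. by rewrite -ler0c -normE. Qed.

Lemma hnorm0 : hnorm (0 : V) = 0.
Proof. by rewrite /hnorm normr0. Qed.

Lemma hnorm0_eq0 x : hnorm x = 0 -> x = 0.
Proof. by move=> x0; apply/normr0_eq0; rewrite normE x0. Qed.

Lemma hnormN x : hnorm (- x) = hnorm x.
Proof. by rewrite /hnorm normrN. Qed.

Lemma hdistC x y : hnorm (x - y) = hnorm (y - x).
Proof. by rewrite /hnorm distrC. Qed.

Lemma hnormD x y : hnorm (x + y) <= hnorm x + hnorm y.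
Proof. by rewrite -lecR rmorphD /= -!normE ler_normD. Qed.

Lemma hnormB x y : hnorm (x - y) <= hnorm x + hnorm y.
Proof. by rewrite -(hnormN y); exact: hnormD. Qed.

Lemma hnorm_small (C : R) x : (forall e, 0 < e -> hnorm x <= C * e) -> x = 0.
Proof.
move=> x0; apply: hnorm0_eq0; apply/eqP; rewrite eq_le hnorm_ge0 andbT.
apply/ler_addgt0Pr => e e0; rewrite add0r.
have C0 : 0 < `|C| + 1 by have := normr_ge0 C; lra.
apply: le_trans (x0 (e / (`|C| + 1)) _) _; first by rewrite divr_gt0.
rewrite mulrCA -[leRHS]mulr1 ler_wpM2l ?(ltW e0)// ler_pdivrMr// mul1r.
by have := ler_norm C; lra.
Qed.

End Hnorm.

Lemma cnormM (R : realType) (a b : R[i]) : hnorm (a * b) = hnorm a * hnorm b.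
Proof. by apply: complexI; rewrite rmorphM /= -!normE normrM. Qed.

Lemma cnormJ (R : realType) (a : R[i]) : hnorm (Num.conj a) = hnorm a.
Proof. by apply: complexI; rewrite -!normE norm_conjC. Qed.

Lemma cnormR (R : realType) (a : R) : hnorm (a%:C%C : R[i]) = `|a|.
Proof. by apply: complexI; rewrite -normE normc_def /= expr0n addr0 sqrtr_sqr. Qed.

Lemma Re_le_cnorm (R : realType) (a : R[i]) : complex.Re a <= hnorm a.
Proof.
by rewrite -lecR -normE; apply: le_trans (normc_ge_Re a); rewrite lecR ler_norm.
Qed.

Lemma sqr_cnorm (R : realType) (a : R[i]) :
  ((hnorm a ^+ 2)%:C)%C = a * Num.conj a.
Proof. by rewrite rmorphXn /= -normE normCK. Qed.

(** * Inner products and the Cauchy-Schwarz inequality *)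

Section Hdot.
Variables (R : realType) (V : hilbertType R).
Implicit Types (x y : V) (a : R[i]).

Lemma hnormZ a x : hnorm (a *: x) = hnorm a * hnorm x.
Proof. by apply: complexI; rewrite rmorphM /= -!normE normrZ. Qed.

Lemma hdotC x y : '[x, y] = Num.conj '[y, x].
Proof. by rewrite (hermC (@hdot R V) x y) expr0 mul1r. Qed.

Lemma hdot_sqr x : '[x, x] = (hnorm x ^+ 2)%:C%C.
Proof. by rewrite hdotE normE rmorphXn. Qed.

Lemma hnorm_sqr x : hnorm x ^+ 2 = complex.Re '[x, x].
Proof. by rewrite hdot_sqr. Qed.

Lemma hdotDl x y z : '[x + y, z] = '[x, z] + '[y, z].
Proof. exact: linearDl. Qed.

Lemma hdotDr x y z : '[x, y + z] = '[x, y] + '[x, z].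
Proof. exact: linearDr. Qed.

Lemma hdotBl x y z : '[x - y, z] = '[x, z] - '[y, z].
Proof. exact: linearBl. Qed.

Lemma hdotBr x y z : '[x, y - z] = '[x, y] - '[x, z].
Proof. exact: linearBr. Qed.

Lemma hdotNr x y : '[x, - y] = - '[x, y].
Proof. exact: linearNr. Qed.

Lemma hdotZl a x y : '[a *: x, y] = a * '[x, y].
Proof. by rewrite linearZl_LR. Qed.

Lemma hdotZr a x y : '[x, a *: y] = Num.conj a * '[x, y].
Proof. by rewrite linearZr_LR. Qed.

Lemma hdot0l x : '[0, x] = 0.
Proof. exact: linear0l. Qed.

Lemma hdot0r x : '[x, 0] = 0.
Proof. exact: linear0r. Qed.

Lemma hdot_sumr (I : Type) (r : seq I) (F : I -> V) y :
  '[y, \sum_(i <- r) F i] = \sum_(i <- r) '[y, F i].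
Proof. exact: linear_sumr. Qed.

Lemma hdot_eql x y : (forall z, '[x, z] = '[y, z]) -> x = y.
Proof.
move=> xy; apply/eqP; rewrite -subr_eq0; apply/eqP/hnorm0_eq0/eqP.
by rewrite -sqrf_eq0 hnorm_sqr hdotBl xy subrr.
Qed.

Lemma hnormD_sqr x y :
  hnorm (x + y) ^+ 2 = hnorm x ^+ 2 + hnorm y ^+ 2 + 2 * complex.Re '[x, y].
Proof.
rewrite !hnorm_sqr hdotDl !hdotDr (hdotC y x).
by move: '[x, x] '[y, y] '[x, y] => [a ?] [b ?] [c ?] /=; ring.
Qed.

Lemma hdot_CauchySchwarz x y : hnorm '[x, y] <= hnorm x * hnorm y.
Proof.
have [->|y0] := eqVneq y 0; first by rewrite hdot0r !hnorm0 mulr0.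
have ny0 : 0 < hnorm y.
  by rewrite lt_def hnorm_ge0 andbT; apply: contra_neq y0 => /hnorm0_eq0.
(* The squared norm of |y|^2 x - <x, y> y equals |y|^2 (|x|^2 |y|^2 - |<x, y>|^2). *)
have := sqr_ge0 (hnorm ((hnorm y ^+ 2)%:C%C *: x + (- '[x, y]) *: y)).
rewrite hnormD_sqr !hnormZ hnormN cnormR hdotZl hdotZr rmorphN mulNr.
rewrite [_ * '[x, y]]mulrC -sqr_cnorm -rmorphN -rmorphM /= ger0_norm ?sqr_ge0//.
set a := hnorm '[x, y]; set b := hnorm y; set c := hnorm x => h.
have : 0 <= b ^+ 2 * ((c * b) ^+ 2 - a ^+ 2).
  apply: le_trans h _; rewrite le_eqVlt; apply/orP; left; apply/eqP. ring.
rewrite pmulr_rge0 ?exprn_gt0// subr_ge0 ler_sqr ?nnegrE ?hnorm_ge0//.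
by rewrite mulr_ge0 ?hnorm_ge0.
Qed.

End Hdot.

(** * Completeness and Riesz representation *)

Lemma real_of_pos (R : realType) (e : R[i]) :
  0 < e -> exists2 r : R, 0 < r & e = r%:C%C.
Proof.
move=> e0; exists (complex.Re e); last by rewrite RRe_real ?gtr0_real.
by move: e0; rewrite ltcE => /andP[].
Qed.

(* Both minimizing sequences and nets of partial sums of orthogonal families *)
(* are Cauchy for this reason, [d a] being the defect of [v a] from optimality. *)
Lemma approx_limit (R : realType) (V : hilbertType R) (S : Type) (v : S -> V)
    (d : S -> R) :
  (forall a b, hnorm (v a - v b) ^+ 2 <= 2 * (d a + d b)) ->
  (forall e, 0 < e -> exists a, d a < e) ->
  exists l, forall e, 0 < e ->
    exists2 r, 0 < r & forall a, d a < r -> hnorm (l - v a) < e.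
Proof.
move=> vd d0.
(* The images under [v] of the sublevel sets of [d] generate a Cauchy filter, whatever the index
   type [S]. *)
pose F := filter_from [set r : R | 0 < r]
  (fun r => [set v a | a in [set a | d a < r]]).
have FF : ProperFilter F.
  apply: filter_from_proper; last by move=> r /d0[a ar]; exists (v a), a.
  apply: filter_from_filter; first by exists 1 => /=.
  move=> r s r0 s0; exists (Num.min r s) => /=; first by rewrite lt_min r0.
  move=> _ [a + <-]; rewrite /= lt_min => /andP[ar as_].
  by split; exists a.
have near_dist (e : R) : 0 < e ->
    exists2 r, 0 < r & forall a b, d a < r -> d b < r -> hnorm (v a - v b) < e.
  move=> e0; exists (e ^+ 2 / 4); first by rewrite divr_gt0 ?exprn_gt0.
  move=> a b ar br; rewrite -ltr_sqr ?nnegrE ?hnorm_ge0 ?ltW//.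
  by apply: le_lt_trans (vd a b) _; lra.
have cvF : cvg F.
  apply: cauchy_cvg; apply: cauchy_exP => _ /real_of_pos[e e0 ->].
  have [r r0 vr] := near_dist e e0; have [a ar] := d0 _ r0.
  exists (v a); exists r => // _ [b br <-].
  by rewrite -ball_normE /= normE ltcR; exact: vr.
exists (lim F) => e e0.
have e20 : 0 < e / 2 by rewrite divr_gt0.
have [r r0 vr] := near_dist _ e20.
exists r => // a ar.
have : F (ball (lim F) (e / 2)%:C%C).
  by apply: cvF; apply: nbhsx_ballx; rewrite ltcR.
move=> [s s0 sF]; have [b] := d0 (Num.min r s) ltac:(by rewrite lt_min r0).
rewrite lt_min => /andP[br bs].
have : ball (lim F) (e / 2)%:C%C (v b) by apply: sF; exists b.
rewrite -ball_normE /= normE ltcR => lb.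
rewrite -[_ - _](subrKA (v b)).
by have := hnormD (lim F - v b) (v b - v a); have := vr _ _ br ar; lra.
Qed.

(* Riesz representation of the functional [A x |-> phi x] on the possibly *)
(* non-closed subspace [A W]; the last clause says that the representing *)
(* vector lies in the closure of [A W]. *)
Lemma riesz (R : realType) (W : lmodType R[i]) (H : hilbertType R) (A : W -> H)
    (phi : W -> R[i]) (M : R) :
  linear A -> scalar phi -> 0 <= M ->
  (forall x, hnorm (phi x) <= M * hnorm (A x)) ->
  exists v, [/\ forall x, phi x = '[A x, v], hnorm v <= M &
    forall w, (forall x, '[A x, w] = 0) -> '[v, w] = 0].
Proof.
move=> linA linphi M0 phiM.
have AD x y : A (x + y) = A x + A y by have := linA 1 x y; rewrite !scale1r.
have A0 : A 0 = 0 by apply: (addrI (A 0)); rewrite -AD !addr0.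
have AZ a x : A (a *: x) = a *: A x by have := linA a x 0; rewrite A0 !addr0.
have phiD x y : phi (x + y) = phi x + phi y.
  by have := linphi 1 x y; rewrite scale1r mul1r.
have phi0 : phi 0 = 0 by apply: (addrI (phi 0)); rewrite -phiD !addr0.
have phiZ a x : phi (a *: x) = a * phi x.
  by have := linphi a x 0; rewrite phi0 !addr0.
(* If v represents [phi], then f x = |A x - v|^2 - |v|^2; minimizing [f] therefore approaches v
   without naming it. *)
pose f x := hnorm (A x) ^+ 2 - 2 * complex.Re (phi x).
have f_ge x : - M ^+ 2 <= f x.
  have := sqr_ge0 (hnorm (A x) - M); have := Re_le_cnorm (phi x).
  by rewrite /f; have := phiM x; nra.
pose m := inf (range f).
have f_inf : has_inf (range f).
  split; first by exists (f 0), 0.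
  by exists (- M ^+ 2) => _ [x _ <-]; exact: f_ge.
have m_le x : m <= f x by apply: ge_inf; [exact: f_inf.2 | exists x].
pose d x := f x - m.
(* Parallelogram law: f at the midpoint is (f x + f y)/2 - |A x - A y|^2/4, and it is at least m. *)
have dA x y : hnorm (A x - A y) ^+ 2 <= 2 * (d x + d y).
  have := m_le ((2^-1)%:C%C *: (x + y)).
  have -> : f ((2^-1)%:C%C *: (x + y)) =
      (f x + f y) / 2 - hnorm (A x - A y) ^+ 2 / 4.
    rewrite /f AZ AD phiZ phiD hnormZ cnormR exprMn !hnormD_sqr hnormN.
    rewrite (@ger0_norm _ 2^-1)// hdotNr.
    move: ('[A x, A y]) (phi x) (phi y) => [a ?] [b ?] [c ?] /=.
    by field.
  by rewrite /d; lra.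
have d0 e : 0 < e -> exists x, d x < e.
  move=> e0; have [_ [x _ <-] xe] := inf_adherent e0 f_inf.
  by exists x; rewrite /d ltrBlDl.
have [v vA] := approx_limit dA d0.
have vsmall e c : 0 < e -> 0 < c -> exists x, d x < c /\ hnorm (v - A x) < e.
  move=> e0 c0; have [r r0 rv] := vA e e0.
  have [x] := d0 (Num.min r c) ltac:(by rewrite lt_min r0).
  by rewrite lt_min => /andP[xr xe]; exists x; split => //; exact: rv.
have phiE x : phi x = '[A x, v].
  apply/eqP; rewrite -subr_eq0; apply/eqP.
  apply: (@hnorm_small _ _ (1 + hnorm (A x))) => e e0.
  (* Variational argument: with b = phi x - <A x, A a>, moving [a] by s conj(b) x lowers [f] by at
     least s |b|^2. As f a is within s e^2 of the infimum, |b| <= e. *)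
  pose s := (hnorm (A x) ^+ 2 + 1)^-1.
  have s0 : 0 < s by rewrite invr_gt0 ltr_wpDl ?sqr_ge0.
  have s1 : s * hnorm (A x) ^+ 2 <= 1.
    by rewrite mulrC ler_pdivrMr ?ltr_wpDl ?sqr_ge0// mul1r lerDl.
  have [a [ad av]] := vsmall e (s * e ^+ 2) e0
    ltac:(by rewrite mulr_gt0 ?exprn_gt0).
  pose b := phi x - '[A x, A a]; pose t := s%:C%C * Num.conj b.
  have fE : f (a + t *: x) =
      f a + s ^+ 2 * hnorm b ^+ 2 * hnorm (A x) ^+ 2 - 2 * (s * hnorm b ^+ 2).
    have tb : complex.Re (t * b) = s * hnorm b ^+ 2.
      by rewrite /t -mulrA [_ * b]mulrC -sqr_cnorm -rmorphM.
    rewrite -tb /f AD AZ hnormD_sqr phiD phiZ hdotZr hnormZ cnormM cnormR cnormJ.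
    rewrite hdotC -rmorphM /b mulrBr (ger0_norm (ltW s0)).
    move: (t * _) (t * phi x) => [c ?] [c' ?] /=; move: (phi a) => [c'' ?] /=.
    by ring.
  have be : hnorm b <= e.
    rewrite -ler_sqr ?nnegrE ?hnorm_ge0 ?(ltW e0)// -(ler_pM2l s0).
    have := m_le (a + t *: x); rewrite fE; move: ad; rewrite /d.
    have : s * hnorm (A x) ^+ 2 * (s * hnorm b ^+ 2) <= s * hnorm b ^+ 2.
      by rewrite ler_piMl// mulr_ge0 ?sqr_ge0// ltW.
    by nra.
  have -> : phi x - '[A x, v] = b - '[A x, v - A a] by rewrite hdotBr /b; ring.
  apply: le_trans (hnormB _ _) _; rewrite mulrDl mul1r lerD//.
  by apply: le_trans (hdot_CauchySchwarz _ _) _; rewrite ler_wpM2l ?hnorm_ge0// ltW.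
exists v; split=> //.
- have [->|v0] := eqVneq v 0; first by rewrite hnorm0.
  have nv0 : 0 < hnorm v.
    by rewrite lt_def hnorm_ge0 andbT; apply: contra_neq v0 => /hnorm0_eq0.
  rewrite -(ler_pM2r nv0) -expr2; apply/ler_addgt0Pr => e e0.
  (* The vector v may lie outside the range of A. Replacing it by a nearby A x costs at most (|v| +
     M) |v - A x| in the bound |v|^2 <= M |v|. *)
  have [x [_ xe]] := vsmall (e / (hnorm v + M)) 1
    ltac:(by rewrite divr_gt0 ?ltr_wpDr) ltr01.
  have : hnorm v ^+ 2 <= hnorm (v - A x) * hnorm v + M * hnorm (A x).
    apply: le_trans (lerD (hdot_CauchySchwarz _ _) (phiM x)).
    apply: le_trans (hnormD _ _); rewrite phiE -hdotDl subrK hdot_sqr cnormR.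
    by rewrite ger0_norm ?sqr_ge0.
  have : hnorm (A x) <= hnorm v + hnorm (v - A x).
    by have := hnormB v (v - A x); rewrite opprB addrC subrK.
  move: xe; rewrite ltr_pdivlMr ?ltr_wpDr//.
  by nra.
- move=> w Aw; apply: (@hnorm_small _ _ (hnorm w)) => e e0.
  have [x [_ xe]] := vsmall e 1 e0 ltr01.
  rewrite -['[v, w]]subr0 -(Aw x) -hdotBl.
  apply: le_trans (hdot_CauchySchwarz _ _) _.
  by rewrite mulrC ler_wpM2l ?hnorm_ge0// ltW.
Qed.

(** * Bounded operators, adjoints and contractions *)

Section Operators.
Variables (R : realType) (H K : hilbertType R).
Implicit Types X : H -> K.

Lemma linear_opB X : linear X -> {morph X : x y / x - y}.
Proof.
move=> linX x y; rewrite -scaleN1r addrC linX scaleN1r.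
by rewrite addrC.
Qed.

Lemma linear_op0 X : linear X -> X 0 = 0.
Proof. by move=> linX; rewrite -(subrr 0) linear_opB// subrr. Qed.

Lemma linear_opZ X : linear X -> forall a x, X (a *: x) = a *: X x.
Proof.
by move=> linX a x; rewrite -[a *: x]addr0 linX linear_op0// addr0.
Qed.

Lemma bounded_opP X : bounded_op X <->
  linear X /\ exists2 M : R, 0 <= M & forall x, hnorm (X x) <= M * hnorm x.
Proof.
split=> [[linX [M XM]]|[linX [M M0 XM]]]; split=> //.
- exists `|complex.Re M| => // x.
  have := XM x; rewrite !normE lecE => /andP[_] /=.
  have -> : complex.Re (M * (hnorm x)%:C%C) = complex.Re M * hnorm x.
    by case: M {XM} => a b /=; rewrite mulr0 subr0.
  by move/le_trans; apply; rewrite ler_wpM2r ?hnorm_ge0 ?ler_norm.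
- by exists M%:C%C => h; rewrite !normE -rmorphM lecR.
Qed.

(** Riesz with A = [id] represents each functional h |-> <X h, k>, so the choice in [adjoint] does
    not fall back on its default. *)
Lemma adjointP X : bounded_op X -> forall h k, '[X h, k] = '[h, adjoint X k].
Proof.
move=> /bounded_opP[linX [M M0 XM]].
suff : exists Y : K -> H, forall h k, '[X h, k] = '[h, Y k].
  by move=> exY h k; rewrite /adjoint; case: xgetP => [Y _ ->//|/forallNP].
pose P k y := forall h, '[X h, k] = '[h, y].
suff /choice[Y PY] : forall k, exists y, P k y by exists Y => h k; exact: PY.
move=> k.
have [||||v [vP _ _]] := @riesz R H H id (fun h => '[X h, k]) (M * hnorm k).
- by [].
- by move=> a x y /=; rewrite linX hdotDl hdotZl.
- by rewrite mulr_ge0 ?hnorm_ge0.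
- move=> x; apply: le_trans (hdot_CauchySchwarz _ _) _.
  by rewrite mulrAC ler_wpM2r ?hnorm_ge0.
by exists v.
Qed.

Lemma adjointPr X : bounded_op X -> forall h k, '[adjoint X k, h] = '[k, X h].
Proof. by move=> bX h k; rewrite hdotC -adjointP// -hdotC. Qed.

(** Boundedness of X makes [sup] a genuine least upper bound; homogeneity carries the estimate from
    the unit ball to all vectors. *)
Lemma opnorm_le1P X : bounded_op X ->
  opnorm X <= 1 <-> forall h, hnorm (X h) <= hnorm h.
Proof.
move=> bX; have [linX [M M0 XM]] := (bounded_opP X).1 bX.
set B := [set complex.Re `|X h| | h in [set h : H | `|h| <= 1]].
have supB : has_sup B.
  split; first by exists (hnorm (X 0)), 0 => //=; rewrite normr0.
  exists M => _ [h /= h1 <-]; apply: le_trans (XM h) _.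
  by rewrite ler_piMr// -lecR -normE.
split=> [X1 h|X1].
- have [->|h0] := eqVneq h 0; first by rewrite linear_op0// !hnorm0.
  have nh0 : 0 < hnorm h.
    by rewrite lt_def hnorm_ge0 andbT; apply: contra_neq h0 => /hnorm0_eq0.
  have : hnorm (X (((hnorm h)^-1)%:C%C *: h)) <= 1.
    apply: le_trans X1; apply: ub_le_sup; first exact: supB.2.
    exists (((hnorm h)^-1)%:C%C *: h) => //=.
    rewrite normE hnormZ cnormR gtr0_norm ?invr_gt0// mulVf ?lt0r_neq0//.
  rewrite linear_opZ// hnormZ cnormR gtr0_norm ?invr_gt0// mulrC.
  by rewrite ler_pdivrMr// mul1r.
- apply: ge_sup; first exact: supB.1.
  move=> _ [h /= h1 <-]; apply: le_trans (X1 h) _.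
  by rewrite -lecR -normE.
Qed.

End Operators.

(* Unconditional sums *)
#[local] Existing Instance summability.totally_filter.

(* Unconditional summation, with the filter [summability.totally] unfolded. *)
Definition sums (R : realType) (V : normedZmodType R[i]) (I : choiceType)
    (f : I -> V) (s : V) :=
  forall e : R, 0 < e -> exists F0 : {fset I}, forall F : {fset I},
    (F0 `<=` F)%fset -> hnorm (s - \sum_(i <- F) f i) < e.

Lemma family_sumP (R : realType) (T : choiceType) (E : set T) (f : T -> R[i])
    s :
  family_sum E f s <-> sums (fun e : E => f (val e)) s.
Proof.
rewrite /family_sum; split=> [fs e e0|fs].
- move/cvgrPdist_lt : fs => /(_ e%:C%C); rewrite ltcR => /(_ e0)[F0 _ F0P].
  exists F0 => F FF; have := F0P F FF.
  rewrite /= /summability.partial_sum /=.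
  by rewrite -(big_seq_fsetE _ F xpredT (fun e : E => f (val e))) /= normE ltcR.
- apply/cvgrPdist_lt => _ /real_of_pos[e e0 ->].
  have [F0 F0P] := fs e e0; exists F0 => // F /F0P.
  rewrite /= /summability.partial_sum /=.
  by rewrite -(big_seq_fsetE _ F xpredT (fun e : E => f (val e))) /= normE ltcR.
Qed.

Lemma big_fset_diff (I : choiceType) (V : zmodType) (f : I -> V)
    (F G : {fset I}) : (F `<=` G)%fset ->
  \sum_(i <- G) f i = \sum_(i <- F) f i + \sum_(i <- (G `\` F)%fset) f i.
Proof.
move=> FG; rewrite (big_fsetID _ (mem F))/=; congr (_ + _).
- by apply: eq_fbigl => i; rewrite !inE /= andbC;
    case: (boolP (i \in F)) => // /(fsubsetP FG).
- by apply: eq_fbigl => i; rewrite !inE /= andbC.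
Qed.

Section Sums.
Variables (R : realType) (I : choiceType).

Lemma sums_unique (V : normedZmodType R[i]) (f : I -> V) s s' :
  sums f s -> sums f s' -> s = s'.
Proof.
move=> fs fs'; apply/eqP; rewrite -subr_eq0; apply/eqP.
apply: (@hnorm_small _ _ 2) => e e0.
have [F FP] := fs e e0; have [F' F'P] := fs' e e0.
have := FP _ (fsubsetUl F F'); have := F'P _ (fsubsetUr F F').
set t := \sum_(i <- _) _ => ? ?.
rewrite -[_ - _](subrKA t); have := hnormD (s - t) (t - s').
by rewrite (hdistC t); lra.
Qed.

(** Asking only for compatibility with subtraction covers operators as well as scalar functionals z
    |-> <z, y>. *)
Lemma sums_map (V W : normedZmodType R[i]) (g : V -> W) (C : R) (f : I -> V) s :
  {morph g : x y / x - y} -> (forall x, hnorm (g x) <= C * hnorm x) ->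
  sums f s -> sums (g \o f) (g s).
Proof.
move=> gB gC fs e e0.
have g0 : g 0 = 0 by rewrite -(subrr 0) gB subrr.
have gD x y : g (x + y) = g x + g y.
  by rewrite -[y in LHS]opprK gB -(sub0r y) gB g0 sub0r opprK.
have C0 : 0 < `|C| + 1 by have := normr_ge0 C; lra.
have [F0 F0P] := fs (e / (`|C| + 1)) ltac:(by rewrite divr_gt0).
exists F0 => F /F0P; rewrite -(big_morph g gD g0) -gB ltr_pdivlMr// => h.
apply: le_lt_trans (gC _) _; apply: le_lt_trans h; rewrite mulrC.
by rewrite ler_wpM2l ?hnorm_ge0//; have := ler_norm C; lra.
Qed.

Lemma sums_single (V : normedZmodType R[i]) (f : I -> V) i :
  (forall j, j != i -> f j = 0) -> sums f (f i).
Proof.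
move=> f0 e e0; exists [fset i]%fset => F; rewrite fsub1set => iF.
rewrite (big_fsetD1 i iF)/= big1_fset ?addr0 ?subrr ?hnorm0//.
by move=> j; rewrite !inE => /andP[/f0].
Qed.

Lemma sums_le (V : normedZmodType R[i]) (f : I -> V) s (C : R) :
  (forall F : {fset I}, hnorm (\sum_(i <- F) f i) <= C) ->
  sums f s -> hnorm s <= C.
Proof.
move=> fC fs; apply/ler_addgt0Pr => e /fs[F /(_ F (fsubset_refl _))].
have := fC F; set t := \sum_(i <- F) _; have := hnormD (s - t) t.
by rewrite subrK; lra.
Qed.

(** Enlarging F by a set beyond which partial sums are within 1 of s can only increase a sum of
    nonnegative terms. *)
Lemma sums_bounded (f : I -> R) (s : R[i]) :
  (forall i, 0 <= f i) -> sums (fun i => (f i)%:C%C) s ->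
  exists C, forall F : {fset I}, \sum_(i <- F) f i <= C.
Proof.
move=> f0 fs; have [F0 F0P] := fs 1 ltr01.
exists (hnorm s + 1) => F; have := F0P _ (fsubsetUr F F0).
rewrite -rmorph_sum (@big_fset_diff _ R _ _ _ (fsubsetUl F F0)).
set a := \sum_(i <- F) _; set b := \sum_(i <- _) _.
have b0 : 0 <= b by apply: sumr_ge0.
have := hnormB s (s - (a + b)%:C%C); rewrite opprB addrC subrK cnormR.
by have := ler_norm (a + b); lra.
Qed.

End Sums.

(** * Orthogonal families *)

Section Orthogonal.
Variables (R : realType) (V : hilbertType R) (I : choiceType) (v : I -> V).
Hypothesis orthv : forall i j, i != j -> '[v i, v j] = 0.

Lemma pythagoras (F : {fset I}) :
  hnorm (\sum_(i <- F) v i) ^+ 2 = \sum_(i <- F) hnorm (v i) ^+ 2.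
Proof.
elim: (enum_fset F) (fset_uniq F) => [_|i r IH /= /andP[ir ur]].
  by rewrite !big_nil hnorm0 expr0n.
rewrite !big_cons hnormD_sqr IH// hdot_sumr.
rewrite [X in complex.Re X]big1_seq ?mulr0 ?addr0// => j /= jr.
by apply: orthv; apply: contraNneq ir => ->.
Qed.

(** By Pythagoras, nested partial sums are at squared distance Q G - Q F. Arbitrary F and G are
    compared through their union, and the gap between Q and its supremum is the defect for
    [approx_limit]. *)
Lemma orthogonal_sums (C : R) :
  (forall F : {fset I}, \sum_(i <- F) hnorm (v i) ^+ 2 <= C) ->
  exists s, sums v s.
Proof.
move=> vC; pose Q (F : {fset I}) := \sum_(i <- F) hnorm (v i) ^+ 2.
have supQ : has_sup (range Q).
  by split; [exists (Q fset0), fset0 | exists C => _ [F _ <-]; exact: vC].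
have QM F : Q F <= sup (range Q) by apply: ub_le_sup; [exact: supQ.2 | exists F].
have Qdiff F G : (F `<=` G)%fset ->
    hnorm (\sum_(i <- G) v i - \sum_(i <- F) v i) ^+ 2 = Q G - Q F.
  move=> FG; rewrite /Q !(big_fset_diff _ FG) addrC addKr pythagoras.
  by rewrite addrC addKr.
pose d F := sup (range Q) - Q F.
have dP (F G : {fset I}) :
    hnorm (\sum_(i <- F) v i - \sum_(i <- G) v i) ^+ 2 <= 2 * (d F + d G).
  have := Qdiff _ _ (fsubsetUl F G); have := Qdiff _ _ (fsubsetUr F G).
  set t := \sum_(i <- (F `|` G)%fset) _; set a := \sum_(i <- F) _.
  set b := \sum_(i <- G) _.
  have := hnormD (a - t) (t - b); rewrite subrKA (hdistC a t).
  have := QM (F `|` G)%fset; rewrite /d.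
  have := hnorm_ge0 (a - b).
  by have := sqr_ge0 (hnorm (t - a) - hnorm (t - b)); nra.
have d0 e : 0 < e -> exists F, d F < e.
  move=> e0; have [_ [F _ <-] Fe] := sup_adherent e0 supQ.
  by exists F; rewrite /d; lra.
have [s sP] := approx_limit dP d0; exists s => e e0.
have [r r0 {}sP] := sP e e0; have [F0 F0r] := d0 _ r0.
exists F0 => F F0F; apply: sP; apply: le_lt_trans F0r.
rewrite /d; have := Qdiff _ _ F0F.
by have := sqr_ge0 (hnorm (\sum_(i <- F) v i - \sum_(i <- F0) v i)); lra.
Qed.

(** The hypothesis says that each v i is the component of s along v i. This unnormalized form serves
    both <x, e> e and U[t] e \otimes J e. *)
Lemma bessel (s : V) (F : {fset I}) : (forall i, '[s, v i] = '[v i, v i]) ->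
  \sum_(i <- F) hnorm (v i) ^+ 2 <= hnorm s ^+ 2.
Proof.
move=> sv; have := sqr_ge0 (hnorm (s - \sum_(i <- F) v i)).
rewrite hnormD_sqr hnormN hdotNr hdot_sumr pythagoras.
rewrite (eq_bigr _ (fun i _ => sv i)).
under [X in complex.Re (- X)]eq_bigr do rewrite hdot_sqr.
by rewrite -rmorph_sum -rmorphN /=; lra.
Qed.

End Orthogonal.

(** * Orthonormal bases *)

(** Zorn: a nonzero vector orthogonal to a maximal orthonormal set could be normalized and added to
    it. *)
Lemma hilbert_basis_ex (R : realType) (H : hilbertType R) :
  exists E : set H, orthonormal_basis E.
Proof.
pose P (E : set H) := (forall e, E e -> '[e, e] = 1) /\
  (forall e f, E e -> E f -> e != f -> '[e, f] = 0).
have [F FP totF|E [[E1 E0] maxE]] := @Zorn_bigcup _ P.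
  split=> [e [A FA Ae]|e f [A FA Ae] [B FB Bf]]; first exact: (FP _ FA).1.
  by have [AB|BA] := totF _ _ FA FB; [apply: (FP _ FB).2 => //; exact: AB |
    apply: (FP _ FA).2 => //; exact: BA].
exists E; split=> // x xE; apply: contrapT => /eqP x0.
have nx0 : hnorm x != 0 by apply: contra_neq x0 => /hnorm0_eq0.
pose u := ((hnorm x)^-1)%:C%C *: x.
have uE e : E e -> '[u, e] = 0 by move=> Ee; rewrite hdotZl xE// mulr0.
have u1 : '[u, u] = 1.
  rewrite hdot_sqr hnormZ cnormR ger0_norm ?invr_ge0 ?hnorm_ge0//.
  by rewrite mulVf// expr1n.
apply: (maxE (E `|` [set u])).
  split; first by move=> e; left.
  move=> /(_ u (or_intror erefl)) /uE /eqP.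
  by rewrite u1 oner_eq0.
split=> [e [/E1//|->//]|e f [Ee|->] [Ef|->]].
- exact: E0.
- by move=> _; rewrite hdotC uE// conjC0.
- by move=> _; rewrite uE.
- by rewrite eqxx.
Qed.

Section Basis.
Variables (R : realType) (H : hilbertType R) (E : set H).
Hypothesis onbE : orthonormal_basis E.

Lemma basis_dot (e f : E) : '[val e, val f] = (e == f)%:R.
Proof.
have [E1 E0 _] := onbE; have [->|ef] := eqVneq; first exact/E1/set_valP.
by apply: E0; [exact: set_valP..|].
Qed.

(** Bessel makes the series converge; its sum has the same coefficients as x, so the difference is
    orthogonal to E and vanishes. *)
Lemma basis_expansion (x : H) : sums (fun e : E => '[x, val e] *: val e) x.
Proof.
have [E1 E0 Emax] := onbE.
pose v (e : E) := '[x, val e] *: val e.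
have vv i j : '[v i, v j] = (i == j)%:R * ('[x, val i] * Num.conj '[x, val j]).
  by rewrite hdotZl hdotZr basis_dot; ring.
have orthv i j : i != j -> '[v i, v j] = 0.
  by move=> /negPf ij; rewrite vv ij mul0r.
have xv i : '[x, v i] = '[v i, v i].
  by rewrite vv eqxx mul1r hdotZr mulrC.
have [s vs] := orthogonal_sums orthv (fun F => bessel orthv F xv).
suff sx : s = x by rewrite sx in vs.
apply/eqP; rewrite -subr_eq0; apply/eqP/Emax => e0 Ee0.
pose e : E := SigSub (mem_set Ee0).
rewrite hdotBl; apply/eqP; rewrite subr_eq0; apply/eqP.
have /sums_unique : sums (fun i => '[v i, val e]) '[s, val e].
  apply: (@sums_map _ _ _ _ (fun z => '[z, val e]) (hnorm (val e)) v) vs.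
  - by move=> y z; rewrite hdotBl.
  - by move=> y; rewrite mulrC; exact: hdot_CauchySchwarz.
apply; have -> : '[x, e0] = '[v e, val e].
  by rewrite hdotZl basis_dot eqxx mulr1.
apply: sums_single => j /negPf je.
by rewrite hdotZl basis_dot je mulr0.
Qed.

Lemma basis_op_ext (K : hilbertType R) (S T : H -> K) :
  bounded_op S -> bounded_op T -> (forall e, E e -> S e = T e) -> S = T.
Proof.
move=> /bounded_opP[linS [M M0 SM]] /bounded_opP[linT [N N0 TN]] ST.
apply/funext => x.
have sumS := sums_map (linear_opB linS) SM (basis_expansion x).
have sumT := sums_map (linear_opB linT) TN (basis_expansion x).
apply: sums_unique sumS _.
rewrite (_ : S \o _ = T \o (fun e : E => '[x, val e] *: val e))//.
by apply/funext => e /=; rewrite !linear_opZ// ST//; exact: set_valP.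
Qed.

End Basis.

(** * Conjugations and pure tensors *)

Section Conjugation.
Variables (R : realType) (H0 : hilbertType R) (J : H0 -> H0).
Hypothesis conjJ : conjugation J.

Lemma conjugation_norm x : hnorm (J x) = hnorm x.
Proof.
have [_ Jdot _] := conjJ.
apply: (@pexpIrn _ 2) => //; rewrite ?nnegrE ?hnorm_ge0//.
by rewrite !hnorm_sqr Jdot; case: '[x, x].
Qed.

Lemma conjugationD x y : J (x + y) = J x + J y.
Proof.
have [linJ _ _] := conjJ.
by have := linJ 1 x y; rewrite /= conjC1 !scale1r.
Qed.

Lemma conjugationZ a x : J (a *: x) = Num.conj a *: J x.
Proof.
have [linJ _ _] := conjJ.
have J0 : J 0 = 0 by apply: (addrI (J 0)); rewrite -conjugationD !addr0.
by have := linJ a x 0; rewrite J0 !addr0.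
Qed.

End Conjugation.

Section PureTensor.
Variables (R : realType) (H H0 : hilbertType R) (T : hilbertTensor H H0).

Lemma tensor_norm h k : hnorm (tensor T h k) = hnorm h * hnorm k.
Proof.
apply: (@pexpIrn _ 2) => //; rewrite ?nnegrE ?mulr_ge0 ?hnorm_ge0//.
by rewrite hnorm_sqr tensor_dot !hdot_sqr -rmorphM /= exprMn.
Qed.

Lemma tensorDr h k k' : tensor T h (k + k') = tensor T h k + tensor T h k'.
Proof. exact: linearDr. Qed.

Lemma tensorZr h a k : tensor T h (a *: k) = a *: tensor T h k.
Proof. by rewrite linearZr_LR. Qed.

Lemma tensorPl a h h' k :
  tensor T (a *: h + h') k = a *: tensor T h k + tensor T h' k.
Proof. by rewrite linearPl. Qed.

Lemma tensor_approx (t : T) (e : R) : 0 < e ->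
  exists n (h : 'I_n -> H) (k : 'I_n -> H0),
    hnorm (t - \sum_i tensor T (h i) (k i)) < e.
Proof.
move=> e0; have e0C : 0 < e%:C%C by rewrite ltcR.
have tB : (ball t e%:C%C) !=set0 by exists t; exact: ballxx.
have [u [tu [n [h [k uE]]]]] := tensor_dense tB (ball_open t _).
exists n, h, k.
by rewrite -uE; move: tu; rewrite -ball_normE /= normE ltcR.
Qed.

Lemma tensor_dot0 (t : T) : (forall h k, '[t, tensor T h k] = 0) -> t = 0.
Proof.
move=> t0; apply: hnorm0_eq0; apply/eqP; rewrite -sqrf_eq0; apply/eqP.
suff : '[t, t] = 0 by rewrite hnorm_sqr => ->.
apply: (@hnorm_small _ _ (hnorm t)) => e /(tensor_approx t)[n [h [k te]]].
have -> : '[t, t] = '[t, t - \sum_i tensor T (h i) (k i)].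
  by rewrite hdotBr hdot_sumr [X in _ - X]big1 ?subr0// => i _; exact: t0.
apply: le_trans (hdot_CauchySchwarz _ _) _.
by rewrite ler_wpM2l ?hnorm_ge0// ltW.
Qed.

(** The difference of the adjoints at any z is orthogonal to all pure tensors, hence zero by
    density. *)
Lemma tensor_op_ext (K : hilbertType R) (Y Z : T -> K) :
  bounded_op Y -> bounded_op Z ->
  (forall h k, Y (tensor T h k) = Z (tensor T h k)) -> Y = Z.
Proof.
move=> bY bZ YZ; apply/funext => t.
apply: hdot_eql => z; rewrite !adjointP//; apply/eqP; rewrite -subr_eq0 -hdotBr.
rewrite hdotC (_ : adjoint Y z - adjoint Z z = 0) ?hdot0l ?conjC0//.
apply: tensor_dot0 => h k.
by rewrite hdotBl !adjointPr// YZ subrr.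
Qed.

End PureTensor.

(** * The operators U[t] and their expansion in a basis *)

Section Slice.
Variables (R : realType) (H H0 : hilbertType R) (J : H0 -> H0).
Hypothesis conjJ : conjugation J.
Variable T : hilbertTensor H H0.
Implicit Types t : T.

(* The operator U_{H,H0}[t], through its matrix coefficients. *)
Definition slice t y : H :=
  xget 0 [set v | forall h, '[v, h] = '[t, tensor T h (J y)]].

Lemma sliceP t y h : '[slice t y, h] = '[t, tensor T h (J y)].
Proof.
suff [v vP] : exists v : H, forall h, '[v, h] = '[t, tensor T h (J y)].
  by rewrite /slice; case: xgetP => [w _ ->//|/(_ v)].
have [||||v [vP _ _]] := @riesz R H H id (fun h => '[tensor T h (J y), t])
    (hnorm y * hnorm t).
- by [].
- by move=> a x z /=; rewrite tensorPl hdotDl hdotZl.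
- by rewrite mulr_ge0 ?hnorm_ge0.
- move=> x; apply: le_trans (hdot_CauchySchwarz _ _) _.
  by rewrite tensor_norm (conjugation_norm conjJ) -mulrA mulrC.
by exists v => h'; rewrite hdotC -vP -hdotC.
Qed.

Lemma slice_norm t y : hnorm (slice t y) <= hnorm t * hnorm y.
Proof.
have [->|v0] := eqVneq (slice t y) 0.
  by rewrite hnorm0 mulr_ge0 ?hnorm_ge0.
have nv0 : 0 < hnorm (slice t y).
  by rewrite lt_def hnorm_ge0 andbT; apply: contra_neq v0 => /hnorm0_eq0.
rewrite -(ler_pM2r nv0) -expr2 hnorm_sqr sliceP.
apply: le_trans (Re_le_cnorm _) _; apply: le_trans (hdot_CauchySchwarz _ _) _.
by rewrite tensor_norm (conjugation_norm conjJ) mulrA mulrAC.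
Qed.

(** The antilinearity of J cancels that of the second argument of the inner product. *)
Lemma slice_linear t : linear (slice t).
Proof.
move=> a x y; apply: hdot_eql => h; rewrite hdotDl hdotZl !sliceP.
rewrite (conjugationD conjJ) (conjugationZ conjJ) tensorDr tensorZr.
by rewrite hdotDr hdotZr conjCK.
Qed.

Lemma slice_linearl : linear slice.
Proof.
move=> a s t; apply/funext => y; apply: hdot_eql => h.
by rewrite hdotDl hdotZl !sliceP hdotDl hdotZl.
Qed.

Lemma slice_bounded t : bounded_op (slice t).
Proof.
apply/bounded_opP; split; first exact: slice_linear.
by exists (hnorm t); [exact: hnorm_ge0|exact: slice_norm].
Qed.

Lemma slice_tensor h k : slice (tensor T h k) = rank_one h (J k).
Proof.
have [_ Jdot JK] := conjJ.
apply/funext => y; apply: hdot_eql => h'.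
rewrite sliceP tensor_dot hdotZl mulrC.
by rewrite -[k in LHS]JK Jdot -hdotC.
Qed.

(** J is onto, so the matrix coefficients of [slice t] include the inner products of t with all pure
    tensors. *)
Lemma slice_inj : injective slice.
Proof.
have [_ _ JK] := conjJ.
move=> s t st; apply/eqP; rewrite -subr_eq0; apply/eqP/tensor_dot0 => h k.
by rewrite -[k]JK hdotBl -!sliceP st subrr.
Qed.

Section SliceBasis.
Variable E : set H0.
Hypothesis onbE : orthonormal_basis E.

(** Pairing the series with h \otimes J e kills every term except the one at e. *)
Lemma slice_sum (w : E -> H) t (e : E) :
  sums (fun f : E => tensor T (w f) (J (val f))) t -> slice t (val e) = w e.
Proof.
have [_ Jdot _] := conjJ.
move=> wt; apply: hdot_eql => h; rewrite sliceP.
pose g f := '[tensor T (w f) (J (val f)), tensor T h (J (val e))].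
have gE f : g f = '[w f, h] * (e == f)%:R.
  by rewrite /g tensor_dot Jdot -hdotC basis_dot.
have /sums_unique : sums g '[t, tensor T h (J (val e))].
  apply: (@sums_map _ _ _ _ (fun z => '[z, _])
    (hnorm (tensor T h (J (val e)))) _ _ _ _ wt).
  - by move=> y z; rewrite hdotBl.
  - by move=> y; rewrite mulrC; exact: hdot_CauchySchwarz.
apply; have -> : '[w e, h] = g e by rewrite gE eqxx mulr1.
by apply: sums_single => f; rewrite eq_sym gE => /negPf->; rewrite mulr0.
Qed.

Lemma tensor_basis_orthogonal (w : E -> H) (e f : E) : e != f ->
  '[tensor T (w e) (J (val e)), tensor T (w f) (J (val f))] = 0.
Proof.
have [_ Jdot _] := conjJ.
by move=> /negPf ef; rewrite tensor_dot Jdot -hdotC basis_dot// eq_sym ef mulr0.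
Qed.

Lemma tensor_basis_norm h (e : E) : hnorm (tensor T h (J (val e))) = hnorm h.
Proof.
have e1 : hnorm (val e) = 1.
  apply: (@pexpIrn _ 2) => //; rewrite ?nnegrE ?hnorm_ge0//.
  by rewrite hnorm_sqr basis_dot// eqxx expr1n.
by rewrite tensor_norm (conjugation_norm conjJ) e1 mulr1.
Qed.

Lemma dot_slice_tensor t (e : E) (v := tensor T (slice t (val e)) (J (val e))) :
  '[t, v] = '[v, v].
Proof. by rewrite -sliceP !hdot_sqr tensor_basis_norm. Qed.

Lemma slice_bessel t (F : {fset E}) :
  \sum_(e <- F) hnorm (slice t (val e)) ^+ 2 <= hnorm t ^+ 2.
Proof.
apply: le_trans (bessel (tensor_basis_orthogonal (slice t \o val)) F
  (dot_slice_tensor t)).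
by under [leRHS]eq_bigr do rewrite tensor_basis_norm.
Qed.

(** The preimage is the orthogonal series of S e \otimes J e. The norm bound is what later makes X
    \otimes I bounded. *)
Lemma slice_surj (S : H0 -> H) (C : R) : bounded_op S ->
  (forall F : {fset E}, \sum_(e <- F) hnorm (S (val e)) ^+ 2 <= C) ->
  exists2 t, slice t = S & hnorm t ^+ 2 <= C.
Proof.
move=> bS SC; pose v (e : E) := tensor T (S (val e)) (J (val e)).
have orthv : forall e f, e != f -> '[v e, v f] = 0 :=
  tensor_basis_orthogonal (S \o val).
have vC (F : {fset E}) : \sum_(e <- F) hnorm (v e) ^+ 2 <= C.
  by under eq_bigr do rewrite tensor_basis_norm.
have [t vt] := orthogonal_sums orthv vC.
exists t.
  apply: (basis_op_ext onbE (slice_bounded t) bS) => e Ee.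
  exact: (@slice_sum (S \o val) t (SigSub (mem_set Ee)) vt).
have C0 : 0 <= C.
  by apply: le_trans (SC fset0); apply: sumr_ge0 => e _;
  exact: sqr_ge0.
rewrite -(sqr_sqrtr C0) ler_sqr ?nnegrE ?hnorm_ge0 ?sqrtr_ge0//.
apply: sums_le vt => F.
rewrite -ler_sqr ?nnegrE ?hnorm_ge0 ?sqrtr_ge0// sqr_sqrtr//.
by rewrite pythagoras.
Qed.

(** Bessel gives a sum s; its slice agrees with that of t on the basis, and injectivity gives s =
    t. *)
Lemma slice_expansion t :
  sums (fun e : E => tensor T (slice t (val e)) (J (val e))) t.
Proof.
pose v (e : E) := tensor T (slice t (val e)) (J (val e)).
have orthv : forall e f, e != f -> '[v e, v f] = 0 :=
  tensor_basis_orthogonal (slice t \o val).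
have [s vs] := orthogonal_sums orthv
  (fun F => bessel orthv F (dot_slice_tensor t)).
suff st : s = t by rewrite st in vs.
apply: slice_inj; apply: (basis_op_ext onbE (slice_bounded s) _) => [|e Ee].
  exact: slice_bounded.
exact: (@slice_sum (slice t \o val) s (SigSub (mem_set Ee)) vs).
Qed.

Lemma slice_parseval s t :
  sums (fun e : E => '[slice s (val e), slice t (val e)]) '[s, t].
Proof.
have -> : (fun e : E => '[slice s (val e), slice t (val e)]) =
    (fun z => '[z, t]) \o (fun e : E => tensor T (slice s (val e)) (J (val e))).
  by apply/funext => e /=; rewrite hdotC sliceP -hdotC.
apply: (@sums_map _ _ _ _ (fun z => '[z, t]) (hnorm t)) (slice_expansion s).
- by move=> y z; rewrite hdotBl.
- by move=> y; rewrite mulrC; exact: hdot_CauchySchwarz.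
Qed.

End SliceBasis.

End Slice.

(** * Identification of [U_HS] with [slice] *)

Section UnitaryHS.
Variables (R : realType) (H H0 : hilbertType R) (J : H0 -> H0).
Hypothesis conjJ : conjugation J.
Variable T : hilbertTensor H H0.

(** Parseval gives the trace formula and, for s = t, the Hilbert-Schmidt property; one basis
    suffices to invert. *)
Lemma slice_unitary : unitary_onto_HS (@slice R H H0 J T).
Proof.
split.
- exact: slice_linearl.
- move=> t; split; first exact: slice_bounded.
  move=> E onbE; exists '[t, t]; apply/family_sumP.
  under [X in sums X]eq_fun do rewrite -hdotE.
  exact: (slice_parseval conjJ onbE).
- move=> s t E onbE; apply/family_sumP.
  under [X in sums X]eq_fun do rewrite /= (adjointPr (slice_bounded conjJ t)).
  exact: (slice_parseval conjJ onbE).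
- move=> S [bS sumS]; have [E onbE] := hilbert_basis_ex H0.
  have [s /family_sumP SE] := sumS E onbE.
  have [C SC] : exists C, forall F : {fset E},
      \sum_(e <- F) hnorm (S (val e)) ^+ 2 <= C.
    apply: (@sums_bounded _ _ (fun e : E => hnorm (S (val e)) ^+ 2) s).
      by move=> e; rewrite sqr_ge0.
    by under [X in sums X]eq_fun do rewrite rmorphXn /= -normE.
  by have [t tS _] := slice_surj conjJ T onbE bS SC; exists t.
Qed.

(* A unitary [U] as in [U_HS] is determined by its values on pure tensors: *)
(* [<U t y, h>] is the trace of [U (h \otimes J y)^* U t]. *)
Lemma U_HSE : @U_HS R H H0 J T = @slice R H H0 J T.
Proof.
have [_ _ JK] := conjJ.
rewrite /U_HS; case: xgetP => [U _ [[_ UHS Utr _] UT]|]; last first.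
  by move=> /(_ (@slice R H H0 J T))[]; split;
    [exact: slice_unitary|exact: slice_tensor].
apply/funext => t; apply/funext => y; apply: hdot_eql => h.
rewrite (sliceP conjJ).
have [E onbE] := hilbert_basis_ex H0.
(* Since J is an involution, U (h \otimes J y) = h y^*. The trace terms become <y, e> <U t e, h>,
   which sum to <U t y, h> by expanding y. *)
have /family_sumP := Utr t (tensor T h (J y)) E onbE.
under [X in sums X]eq_fun => e.
  rewrite /= adjointPr; last by have [] := UHS (tensor T h (J y)).
  rewrite UT /rank_one JK hdotZr -hdotC -hdotZl.
  over.
move=> sumT; apply/esym/(sums_unique sumT).
have [/bounded_opP[linU [M M0 UM]] _] := UHS t.
have -> : (fun e : E => '['[y, val e] *: U t (val e), h]) =
    (fun z => '[U t z, h]) \o (fun e : E => '[y, val e] *: val e).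
  by apply/funext => e /=; rewrite (linear_opZ linU).
apply: (@sums_map _ _ _ _ (fun z => '[U t z, h]) (M * hnorm h))
  (basis_expansion onbE y).
- by move=> x z; rewrite (linear_opB linU) hdotBl.
- move=> x; apply: le_trans (hdot_CauchySchwarz _ _) _.
  by rewrite mulrAC ler_wpM2r ?hnorm_ge0.
Qed.

End UnitaryHS.

(** * The operator X \otimes I as left composition with X *)

Section TensorOp.
Variables (R : realType) (H K H0 : hilbertType R) (J : H0 -> H0).
Hypothesis conjJ : conjugation J.
Variables (HH0 : hilbertTensor H H0) (KH0 : hilbertTensor K H0).

(** An operator Z with the required slices is built first; it agrees with X \otimes I on pure
    tensors, so [tensor_op_ext] identifies it with the chosen [tensor_op]. *)
Lemma slice_tensor_op (X : H -> K) (t : HH0) : bounded_op X ->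
  slice J (tensor_op HH0 KH0 X idfun t) = X \o slice J t.
Proof.
move=> bX; have [linX [M M0 XM]] := (bounded_opP X).1 bX.
suff [Z bZ ZP] : exists2 Z : HH0 -> KH0, bounded_op Z &
    forall t, slice J (Z t) = X \o slice J t.
  have ZT h k : Z (tensor HH0 h k) = tensor KH0 (X h) k.
    apply: (slice_inj conjJ); rewrite ZP !slice_tensor//.
    by apply/funext => y; rewrite /= /rank_one linear_opZ.
  rewrite -ZP /tensor_op; congr (slice J _).
  case: xgetP => [Y _ [bY YT]|/(_ Z)[]]; last by split.
  by rewrite (tensor_op_ext bY bZ)// => h k; rewrite YT ZT.
have [E onbE] := hilbert_basis_ex H0.
(* Left composition with X multiplies the sums of squares by at most M^2, so [slice_surj] inverts X
   U[t]. Injectivity of [slice] then makes the pointwise choice linear. *)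
have /choice[Z ZP] : forall t : HH0, exists u : KH0,
    slice J u = X \o slice J t /\ hnorm u ^+ 2 <= (M * hnorm t) ^+ 2.
  move=> {}t; have [||u uS uC] := @slice_surj _ _ _ J conjJ KH0 E onbE
    (X \o slice J t) ((M * hnorm t) ^+ 2).
  - apply/bounded_opP; split.
      by move=> a x y /=; rewrite slice_linear// linX.
    exists (M * hnorm t); first by rewrite mulr_ge0 ?hnorm_ge0.
    move=> x; apply: le_trans (XM _) _; rewrite -mulrA ler_wpM2l//.
    exact: slice_norm.
  - move=> F.
    rewrite exprMn; apply: le_trans (ler_wpM2l _ (slice_bessel conjJ onbE t F));
      last exact: sqr_ge0.
    rewrite mulr_sumr ler_sum// => e _.
    rewrite -exprMn ler_sqr ?nnegrE ?mulr_ge0 ?hnorm_ge0//; exact: XM.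
  by exists u.
exists Z; last by move=> u; have [] := ZP u.
apply/bounded_opP; split.
  move=> a s u; apply: (slice_inj conjJ).
  rewrite slice_linearl//.
  have [-> _] := ZP (a *: s + u); have [-> _] := ZP s; have [-> _] := ZP u.
  by apply/funext => y; rewrite /= slice_linearl//= linX.
exists M => // u; have [_] := ZP u.
by rewrite ler_sqr ?nnegrE ?mulr_ge0 ?hnorm_ge0.
Qed.

End TensorOp.

(* Douglas' lemma.  The adjoint Y of X is built first: Y k represents *)
(* [A x |-> <B x, k>] on the range of A and lies in its closure, which makes *)
(* it unique, hence linear in k. *)
Lemma contractive_factor (R : realType) (H K H0 : hilbertType R)
    (A : H0 -> H) (B : H0 -> K) : bounded_op A -> bounded_op B ->
  (forall x, hnorm (B x) <= hnorm (A x)) ->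
  exists X : H -> K, [/\ bounded_op X, X \o A = B &
    forall h, hnorm (X h) <= hnorm h].
Proof.
move=> [linA _] [linB _] BA.
have /choice[Y YP] : forall k : K, exists v : H,
    [/\ forall x, '[B x, k] = '[A x, v],
    hnorm v <= hnorm k & forall w, (forall x, '[A x, w] = 0) -> '[v, w] = 0].
  move=> k; apply: riesz => //; rewrite ?hnorm_ge0//.
  - by move=> a x y /=; rewrite linB hdotDl hdotZl.
  - move=> x; apply: le_trans (hdot_CauchySchwarz _ _) _.
    by rewrite mulrC ler_wpM2l ?hnorm_ge0.
have linY : linear Y.
  move=> a k l; apply/eqP; rewrite -subr_eq0; apply/eqP.
  set w := _ - _.
  (* The linearity defect w is orthogonal to the range of A; being a combination of vectors in its
     closure, it is also orthogonal to itself. *)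
  have Aw x : '[A x, w] = 0.
    have [Ykl _ _] := YP (a *: k + l); have [Yk _ _] := YP k.
    have [Yl _ _] := YP l.
    rewrite hdotBr hdotDr hdotZr -Ykl -Yk -Yl hdotDr hdotZr.
    by rewrite subrr.
  have [_ _ /(_ w Aw) Ykl] := YP (a *: k + l).
  have [_ _ /(_ w Aw) Yk] := YP k; have [_ _ /(_ w Aw) Yl] := YP l.
  apply: hnorm0_eq0; apply/eqP; rewrite -sqrf_eq0 hnorm_sqr {1}/w.
  by rewrite hdotBl hdotDl hdotZl Ykl Yk Yl mulr0 addr0 subrr.
have Ynorm k : hnorm (Y k) <= hnorm k by have [] := YP k.
have bY : bounded_op Y.
  by apply/bounded_opP; split=> //; exists 1 => // k; rewrite mul1r.
pose X := adjoint Y.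
have XY h k : '[X h, k] = '[h, Y k] by exact: adjointPr.
have Xnorm h : hnorm (X h) <= hnorm h.
  have [->|x0] := eqVneq (X h) 0; first by rewrite hnorm0 hnorm_ge0.
  have nx0 : 0 < hnorm (X h).
    by rewrite lt_def hnorm_ge0 andbT; apply: contra_neq x0 => /hnorm0_eq0.
  rewrite -(ler_pM2r nx0) -expr2 hnorm_sqr XY.
  apply: le_trans (Re_le_cnorm _) _; apply: le_trans (hdot_CauchySchwarz _ _) _.
  by rewrite ler_wpM2l ?hnorm_ge0.
exists X; split=> //.
- apply/bounded_opP; split; last by exists 1 => // h; rewrite mul1r.
  move=> a g h; apply: hdot_eql => k.
  by rewrite hdotDl hdotZl !XY hdotDl hdotZl.
- apply/funext => x; apply: hdot_eql => k /=.
  by rewrite XY; have [->] := YP k.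
Qed.

Lemma nonpositive_gram_diff (R : realType) (H K H0 : hilbertType R)
    (A : H0 -> H) (B : H0 -> K) : bounded_op A -> bounded_op B ->
  nonpositive_op ((adjoint B \o B) \- (adjoint A \o A)) <->
  forall x, hnorm (B x) <= hnorm (A x).
Proof.
move=> bA bB.
have E x : ('[((adjoint B \o B) \- (adjoint A \o A)) x, x] <= 0) =
    (hnorm (B x) <= hnorm (A x)).
  rewrite /= hdotBl !adjointPr// !hdot_sqr subr_le0 lecR.
  by rewrite ler_sqr ?nnegrE ?hnorm_ge0.
by split=> BA x; have := BA x; rewrite E.
Qed.

Theorem proposition2p3 (R : realType) (H K H0 : hilbertType R)
    (J : H0 -> H0) (conjJ : conjugation J)
    (HH0 : hilbertTensor H H0) (KH0 : hilbertTensor K H0)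
    (p : HH0) (q : KH0) :
  (exists X : H -> K,
     [/\ bounded_op X, tensor_op HH0 KH0 X idfun p = q & opnorm X <= 1]) <->
  nonpositive_op
    ((adjoint (U_HS J KH0 q) \o U_HS J KH0 q) \-
     (adjoint (U_HS J HH0 p) \o U_HS J HH0 p)).
Proof.
rewrite !(U_HSE conjJ).
apply: (iff_trans _ (iff_sym (nonpositive_gram_diff _ _)));
  try exact: slice_bounded.
split=> [[X [bX <- /(opnorm_le1P bX) X1]] x|qp].
  by rewrite (slice_tensor_op conjJ KH0 p bX)/=.
have [X [bX XA X1]] := contractive_factor (slice_bounded conjJ p)
  (slice_bounded conjJ q) qp.
exists X; split=> //; last exact/(opnorm_le1P bX).
(* Injectivity turns X U[p] = U[q] back into (X \otimes I) p = q. *)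
by apply: (slice_inj conjJ); rewrite (slice_tensor_op conjJ).
Qed.
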